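(* For a bounded real sequence $x=(x(n))_{n\in\mathbb{N}}\in\ell_\infty$ let $\operatorname{LIM}(x)=\{y\in\mathbb{R}: x(n_k)\to y\text{ for some increasing sequence }(n_k)_{k\in\mathbb{N}}\}$ be the set of all limit points of $x$. The set of bounded real sequences $x$ for which $\operatorname{LIM}(x)$ is a Cantor set is strongly $\mathfrak{c}$-algebrable (as a subset of the algebra $\ell_\infty$).
   Context: A Cantor set is a subset of $\mathbb{R}$ homeomorphic to the ternary Cantor set. $\mathfrak{c}=2^{\omega}$ is the cardinality of the continuum. $\ell_\infty$ is the real commutative algebra of all bounded real sequences with coordinatewise operations; the sequences $(n_k)$ are strictly increasing sequences of indices. A subset $S$ of a commutative real algebra $\mathcal{L}$ is strongly $\kappa$-algebrable if $S\cup\{0\}$ contains a $\kappa$-generated algebra isomorphic to a free (commutative, non-unital) algebra; equivalently, there is a set $X\subseteq\mathcal{L}$ of cardinality $\kappa$ such that for every $k\ge 1$, every nonzero real polynomial $P$ in $k$ variables without constant term and all distinct $y_1,\dots,y_k\in X$, we have $P(y_1,\dots,y_k)\neq 0$ and $P(y_1,\dots,y_k)\in S$. *)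

(* Defs.v *)
From HB Require Import structures.
From mathcomp Require Import all_boot all_order all_algebra.
From mathcomp Require Import all_classical all_reals all_analysis.
(* The notations of [mpoly] clash with those of the analysis library. *)
From mathcomp Require mpoly.
Import -(notations) mpoly.

Set Implicit Arguments.
Unset Strict Implicit.
Unset Printing Implicit Defensive.

Import Order.TTheory GRing.Theory Num.Theory.
Import numFieldNormedType.Exports.

Local Open Scope classical_set_scope.
Local Open Scope ring_scope.

Section ellinfty.
Variable R : realType.

Definition bounded_seq : {pred nat -> R} := [pred x | `[< bounded_fun x >]].

Record ellinfty : predArgType :=
  Ellinfty { ellinfty_val :> nat -> R; _ : ellinfty_val \in bounded_seq }.

HB.instance Definition _ := [isSub for ellinfty_val].
HB.instance Definition _ := [Choice of ellinfty by <:].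

Lemma bounded_seqP (x : nat -> R) :
  reflect (exists M : R, forall n, `|x n| <= M) (x \in bounded_seq).
Proof.
apply: (iffP (asboolP _)) => [[M [_ xM]]|[M xM]].
  by exists (M + 1) => n; apply: xM => //; rewrite ltrDl.
exists M; split; first exact: num_real.
by move=> N MN n _; exact: le_trans (xM n) (ltW MN).
Qed.

Lemma bounded_seq_subring_closed : subring_closed bounded_seq.
Proof.
split=> [|x y|x y].
- by apply/bounded_seqP; exists 1 => n; rewrite normr1.
- move=> /bounded_seqP[M xM] /bounded_seqP[N yN].
  apply/bounded_seqP; exists (M + N) => n.
  by rewrite (le_trans (ler_normB _ _))// lerD.
- move=> /bounded_seqP[M xM] /bounded_seqP[N yN].
  by apply/bounded_seqP; exists (M * N) => n; rewrite normrM ler_pM.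
Qed.
HB.instance Definition _ :=
  GRing.isSubringClosed.Build _ bounded_seq bounded_seq_subring_closed.

Lemma bounded_seq_scaler_closed : GRing.scaler_closed bounded_seq.
Proof.
move=> a x /bounded_seqP[M xM]; apply/bounded_seqP; exists (`|a| * M) => n.
by rewrite normrM ler_wpM2l.
Qed.
HB.instance Definition _ :=
  GRing.isScaleClosed.Build R (nat -> R) bounded_seq bounded_seq_scaler_closed.

HB.instance Definition _ := [SubChoice_isSubComNzRing of ellinfty by <:].
HB.instance Definition _ := [SubZmodule_isSubLmodule of ellinfty by <:].

Lemma ellinfty_scalerAl (a : R) (x y : ellinfty) : a *: (x * y) = (a *: x) * y.
Proof. by apply/val_inj/funext => n; exact: mulrA. Qed.
HB.instance Definition _ :=
  GRing.Lmodule_isLalgebra.Build R ellinfty ellinfty_scalerAl.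
HB.instance Definition _ := GRing.Lalgebra_isComAlgebra.Build R ellinfty.

End ellinfty.

(* [mmap] rather than [meval]: the coefficients are scalars, the arguments are
   elements of [L]. *)
Definition poly_eval (R : realType) (L : comAlgType R) (k : nat)
    (P : mpoly k R) (y : 'I_k -> L) : L :=
  mmap (GRing.in_alg L) y P.

(* The cardinal is that of the set [K]. The condition on [X] says that [X] freely
   generates, as a commutative non-unital algebra, a subalgebra contained in
   [S] and 0. *)
Definition strongly_algebrable (R : realType) (L : comAlgType R)
    (T : Type) (K : set T) (S : set L) : Prop :=
  exists X : set L, (X #= K)%card /\
    forall (k : nat) (P : mpoly k R) (y : 'I_k -> L),
      (0 < k)%N -> P != 0 -> mcoeff mnm0 P = 0 ->
      injective y -> (forall i, X (y i)) ->
      poly_eval P y != 0 /\ S (poly_eval P y).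

Definition homeomorphic (T U : topologicalType) (A : set T) (B : set U) : Prop :=
  exists (f : T -> U) (g : U -> T),
    [/\ {within A, continuous f}, {within B, continuous g},
        (forall x, A x -> B (f x) /\ g (f x) = x) &
        (forall y, B y -> A (g y) /\ f (g y) = y)].

Fixpoint ternary_step (R : realType) (n : nat) : set R :=
  if n is m.+1 then
    [set x / 3 | x in ternary_step m] `|`
    [set (x + 2) / 3 | x in ternary_step m]
  else `[0, 1]%classic.

Definition ternary_cantor_set (R : realType) : set R :=
  \bigcap_n ternary_step n.

Definition is_cantor_set (R : realType) (A : set R) : Prop :=
  homeomorphic A (@ternary_cantor_set R).

Definition LIM (R : realType) (x : nat -> R) : set R :=
  [set y | exists2 n_ : nat -> nat, increasing_seq n_ &
           x (n_ k) @[k --> \oo] --> y].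

(* Main.v *)
Require Import Defs.
From HB Require Import structures.
From mathcomp Require Import all_boot all_order all_algebra.
From mathcomp Require Import all_classical all_reals all_analysis.
From mathcomp Require Import ring lra.
From mathcomp Require mpoly.
Import -(notations) mpoly.

(** Let [C] be the ternary Cantor set, let [q] be a sequence that lists a
countable dense subset of [C], each of its points infinitely often, and let
the generators be the sequences [n |-> exp (b * q n)], where [b] ranges over a
family [B] of continuum many reals.

A polynomial without constant term in such generators is the sequence [F o q],
where [F x = \sum_m a_m exp (g_m x)] and the exponent [g_m] attached to a
monomial [m] is the corresponding combination of elements of [B] with natural
coefficients. If [B] is linearly independent over the rationals, then the
exponents of distinct nonconstant monomials are distinct and nonzero, so that
[F] is a nontrivial exponential sum. By the choice of [q] and the continuity of
[F], the limit points of [F o q] are exactly the points of [F(C)]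
([LIM_cantor_points]). It remains to see that [F(C)] is a Cantor set, and by
Brouwer's characterization ([homeomorphic_cantor_space]) three properties are
enough besides its being nonempty.
- [F(C)] is compact, because [F] is continuous.
- [F(C)] has no isolated point. If [F x] were isolated in [F(C)] for some [x]
  in the perfect set [C], then [F] would take the value [F x] at points of [C]
  arbitrarily close to [x]. This cannot happen: Rolle's theorem, applied once
  per exponential, shows that the zeros of a nontrivial exponential sum do not
  accumulate ([exp_sum_limit_point_zero]); the constant [F x] counts as one more
  exponential, of exponent 0.
- [F(C)] has empty interior, because [F] is Lipschitz on the unit interval and
  [C] is covered by [2^n] sets of diameter [3^-n], while [(2/3)^n] tends to 0
  ([interior_lipschitz_cantor]).

The family [B] consists of the numbers [\sum_(j in A) 1/j!], where [A] ranges
over the almost disjoint family of the sets of (codes of) finite prefixes of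
binary sequences. Multiplying a vanishing integer combination of such numbers
by [J!] gives an integer plus a remainder of order [1/J], so that the integer is
0 as soon as [J] is large; comparing two successive values of [J] isolates the
coefficient of any [A] that contains [J+1] while the other sets do not
([fact_real_free]). *)

Set Implicit Arguments.
Unset Strict Implicit.
Unset Printing Implicit Defensive.

Import Order.TTheory GRing.Theory Num.Theory.
Import numFieldNormedType.Exports.

Local Open Scope classical_set_scope.
Local Open Scope ring_scope.

(** * Cantor sets on the line *)

Lemma homeomorphic_sym (T U : topologicalType) (A : set T) (B : set U) :
  homeomorphic A B -> homeomorphic B A.
Proof. by case=> f [g [fc gc fK gK]]; exists g, f; split. Qed.

Lemma within_continuous_comp_image (T U V : topologicalType) (A : set T)
    (B : set U) (f : T -> U) (g : U -> V) :
  (forall x, A x -> B (f x)) ->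
  {within A, continuous f} -> {within B, continuous g} ->
  {within A, continuous (g \o f)}.
Proof.
move=> AB /subspace_continuousP fc /subspace_continuousP gc.
apply/subspace_continuousP => x Ax W /(gc _ (AB _ Ax)) /= gW.
have := fc x Ax _ gW; rewrite !nbhs_simpl /within /=.
apply: filterS => y + Ay => /(_ Ay); apply; exact: AB.
Qed.

Lemma homeomorphic_trans (T U V : topologicalType) (B : set U) (A : set T)
    (C : set V) :
  homeomorphic A B -> homeomorphic B C -> homeomorphic A C.
Proof.
move=> [f [g [fc gc fK gK]]] [f' [g' [fc' gc' fK' gK']]].
exists (f' \o f), (g \o g'); split.
- by apply: within_continuous_comp_image fc fc' => x /fK[].
- by apply: within_continuous_comp_image gc' gc => x /gK'[].
- by move=> x /fK[/fK'[? E] ?]; split=> //=; rewrite E.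
- by move=> x /gK'[/gK[? E] ?]; split=> //=; rewrite E.
Qed.

Section cantor_subset.
(* The point [a0] makes the subtype [A] a pointed space, as the Cantor-like
   spaces of [homeomorphism_cantor_like] are. *)
Context (R : realType) (A : set R) (a0 : A).

#[local] HB.instance Definition _ := isPointed.Build (set_type A) a0.

(** Zero-dimensionality is where the empty interior is used: between two points
of [A] there is a real [z] outside [A], and the points of [A] below [z] form a
clopen subset of [A]. *)
Lemma set_type_cantor_like : compact A -> A `<=` limit_point A ->
  A^° = set0 -> cantor_like (set_type A).
Proof.
move=> cA pA iA; split.
- apply/perfectTP => x [B oB Bx].
  have Bvx : B (set_val x) by have : [set x] x by []; rewrite -Bx.
  have [|y [yx Ay By]] := pA _ (set_valP x) B.
    by apply: open_nbhs_nbhs; split.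
  have : [set x] (SigSub (mem_set Ay)) by rewrite -Bx.
  by move=> /(congr1 set_val) /= /eqP; rewrite (negbTE yx).
- move=> F FF _; have [|p [Ap clp]] := cA (set_val @ F) _.
    change (F (set_val @^-1` A)).
    by apply: filterS filterT => x _; exact: (set_valP x).
  exists (SigSub (mem_set Ap)); split=> // B C FB [_ [[D oD <-] Dp DC]].
  have [||z [[x Bx <-] Dx]] := clp (set_val @` B) D.
  - change (F (set_val @^-1` (set_val @` B))).
    by apply: filterS FB => x Bx; exists x.
  - by apply: open_nbhs_nbhs; split.
  - by exists x; split=> //; exact: DC.
- move=> x y xy; apply/val_inj/(@Rhausdorff R) => B C Bx Cy.
  have [z [Bz Cz]] := xy (set_val @^-1` B) (set_val @^-1` C)
    (@initial_continuous A R set_val x B Bx)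
    (@initial_continuous A R set_val y C Cy).
  by exists (set_val z).
- suff main : forall x y : A, set_val x < set_val y ->
    exists U : set A, [/\ clopen U, U x & ~ U y].
    move=> x y; rewrite -(inj_eq val_inj) neq_lt => /orP[/main//|].
    move=> /main[U [cU Uy Ux]].
    by exists (~` U); split; [exact: clopenC|exact: Ux|exact].
  move=> x y xy.
  have [z [xz zy Az]] : exists z, [/\ set_val x < z, z < set_val y & ~ A z].
    apply: contrapT => N; suff: A^° ((set_val x + set_val y) / 2) by rewrite iA.
    have /open_nbhs_nbhs : open_nbhs ((set_val x + set_val y) / 2)
      `]set_val x, set_val y[%classic.
      by split; [exact: itv_open|rewrite /= in_itv/= midf_lt ?midf_lt].
    apply: filterS => z /=; rewrite in_itv/= => /andP[xz zy].
    by apply: contrapT => Az; apply: N; exists z.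
  exists (set_val @^-1` [set t | t < z]); split => //=; last first.
    by rewrite /preimage/=; apply/negP; rewrite -leNgt ltW.
  split; first by exists [set t | t < z] => //; exact: open_lt.
  rewrite -[X in closed X]setCK; apply: open_closedC.
  exists [set t | z < t]; first exact: open_gt.
  apply/seteqP; split=> t /=; first by move=> /ltW zt; apply/negP; rewrite -leNgt.
  move/negP; rewrite -leNgt le_eqVlt => /orP[/eqP E|//].
  by case: Az; rewrite E; exact: (set_valP t).
Qed.

Lemma homeomorphic_cantor_space_pointed : compact A -> A `<=` limit_point A ->
  A^° = set0 -> homeomorphic A [set: cantor_space].
Proof.
move=> cA pA iA.
have [h [hc hcl]] := homeomorphism_cantor_like (set_type_cantor_like cA pA iA).
have hinvL a : valL (h^-1)%FUN (set_val a) = (h^-1)%FUN a.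
  exact: (congr1 (@^~ a) (valLK _ _)).
exists (valL (h^-1)%FUN), (set_val \o h); split.
- apply/subspace_valL_continuousP/continuous_closedP => U /hcl.
  suff -> : (h^-1)%FUN @^-1` U = h @` U by [].
  apply/seteqP; split=> x /=.
    by move=> Ux; exists ((h^-1)%FUN x) => //; rewrite invK// inE.
  by move=> [y Uy <-]; rewrite funK// inE.
- apply: continuous_subspaceT => x; apply: continuous_comp; first exact: hc.
  exact: initial_continuous.
- move=> x Ax; split; first by [].
  change (set_val (h (valL (h^-1)%FUN x)) = x).
  by rewrite (hinvL (SigSub (mem_set Ax))) invK// inE.
- move=> y _; split; first exact: (set_valP (h y)).
  change (valL (h^-1)%FUN (set_val (h y)) = y).
  by rewrite hinvL funK// inE.
Qed.

End cantor_subset.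

(** Brouwer's characterization of the Cantor space, for subsets of the line. *)
Lemma homeomorphic_cantor_space (R : realType) (A : set R) : A !=set0 ->
  compact A -> A `<=` limit_point A -> A^° = set0 ->
  homeomorphic A [set: cantor_space].
Proof.
move=> [a Aa]; exact: (homeomorphic_cantor_space_pointed (SigSub (mem_set Aa))).
Qed.

(** * The ternary Cantor set *)

Section ternary.
Variable R : realType.
Local Notation C := (@ternary_cantor_set R).

(** The two contractions whose images of the Cantor set make it up. *)
Definition third (b : bool) (x : R) : R := (if b then x + 2 else x) / 3.
Definition thirds (s : seq bool) (x : R) : R := foldr third x s.

Lemma ternary_stepS n :
  @ternary_step R n.+1 =
  third false @` ternary_step n `|` third true @` ternary_step n.
Proof. by []. Qed.

Lemma ternary_step_itv n (x : R) : ternary_step n x -> 0 <= x <= 1.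
Proof.
elim: n x => [x|n IH x]; first by rewrite /= in_itv.
by rewrite ternary_stepS => -[[y /IH y01 <-]|[y /IH y01 <-]]; rewrite /third; lra.
Qed.

Lemma cantor_itv x : C x -> 0 <= x <= 1.
Proof. by move=> Cx; apply: (@ternary_step_itv 0); exact: Cx. Qed.

Lemma cantor_third b x : C x -> C (third b x).
Proof.
move=> Cx [|n] _; last first.
  by rewrite ternary_stepS; case: b; [right|left]; exists x => //; exact: Cx.
by have := cantor_itv Cx; rewrite /= in_itv/= /third; case: b; lra.
Qed.

(** At each stage of the construction [x] lies in one of the two images, which a
priori depends on the stage. It does not, because the point 1/2 separates the
images of the unit interval. *)
Lemma cantor_third_inv x : C x -> exists2 y, C y & exists b, x = third b y.
Proof.
move=> Cx; pose b := 2^-1 < x.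
have E y b' : ternary_step 0 y -> x = third b' y -> b' = b.
  move/ternary_step_itv; rewrite /b /third.
  case: b' => y01 ->; [apply/esym; lra|apply/esym/negbTE; rewrite -leNgt; lra].
exists (3 * x - (if b then 2 else 0)); last first.
  by exists b; rewrite /third; case: (b); field.
move=> n _; have := Cx n.+1 I; rewrite ternary_stepS.
have H y b' : ternary_step n y -> third b' y = x ->
    3 * x - (if b then 2 else 0) = y.
  move=> ny yx; rewrite -(E y b') //.
    by rewrite -yx /third; case: (b'); field.
  by rewrite /= in_itv; exact: (ternary_step_itv ny).
by case=> -[y ny yx]; rewrite (H _ _ ny yx).
Qed.

Lemma cantor_thirds s x : C x -> C (thirds s x).
Proof. by move=> Cx; elim: s => //= b s; exact: cantor_third. Qed.

Lemma cantor_thirds_inv n x : C x ->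
  exists2 y, C y & exists t : n.-tuple bool, x = thirds t y.
Proof.
move=> Cx; elim: n => [|n [y Cy [t ->]]]; first by exists x => //; exists [tuple].
have [z Cz [b ->]] := cantor_third_inv Cy; exists z => //.
by exists [tuple of rcons t b]; rewrite /thirds foldr_rcons.
Qed.

Lemma thirdsB s x y : thirds s x - thirds s y = (x - y) / 3 ^+ size s.
Proof.
elim: s => [|b s IH]; first by rewrite expr0 divr1.
rewrite exprS invfM mulrA mulrAC -IH /= /third.
by case: b; field.
Qed.

Lemma cantor0 : C 0.
Proof.
move=> n _; elim: n => [|n IH]; first by rewrite /= in_itv/= lexx ler01.
by left; exists 0 => //; rewrite mul0r.
Qed.

Lemma cantor1 : C 1.
Proof.
move=> n _; elim: n => [|n IH]; first by rewrite /= in_itv/= lexx ler01.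
by right; exists 1 => //; lra.
Qed.

Lemma compact_ternary_step n : compact (@ternary_step R n).
Proof.
elim: n => [|n IH]; first exact: segment_compact.
have ct b : continuous (third b).
  move=> x; rewrite /third; apply: cvgM; last exact: cvg_cst.
  by case: b; [apply: cvgD; [exact: cvg_id|exact: cvg_cst]|exact: cvg_id].
rewrite ternary_stepS; apply: compactU; apply: continuous_compact => //;
  exact: continuous_subspaceT.
Qed.

Lemma compact_cantor : compact C.
Proof.
apply: (subclosed_compact _ (@compact_ternary_step 0)); last first.
  by move=> x Cx; exact: Cx.
apply: closed_bigI => n _; apply: compact_closed; first exact: Rhausdorff.
exact: compact_ternary_step.
Qed.

Lemma geometric_small (a z e : R) : 0 <= z < 1 -> 0 < e ->
  exists n, a * z ^+ n < e.
Proof.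
move=> /andP[z0 z1] e0.
have /cvgr_lt/(_ _ e0)[n _ /(_ n (leqnn n))] : geometric a z @ \oo --> (0 : R).
  by apply: cvg_geometric; rewrite ger0_norm.
by exists n.
Qed.

(** Every point of the Cantor set has arbitrarily small pieces of it nearby; both
the perfectness of the Cantor set and the density of the left endpoints of the
pieces follow. *)
Lemma cantor_near_thirds x (e : R) : C x -> 0 < e ->
  exists s, forall y, 0 <= y <= 1 -> `|x - thirds s y| < e.
Proof.
move=> Cx e0; have [|n] := @geometric_small 1 3^-1 e _ e0; first lra.
rewrite mul1r exprVn => ne.
have [z /cantor_itv z01 [t ->]] := cantor_thirds_inv n Cx.
exists t => y y01; rewrite thirdsB size_tuple normrM (le_lt_trans _ ne)//.
rewrite [X in _ * X]ger0_norm ?invr_ge0 ?exprn_ge0// ler_piMl ?invr_ge0 ?exprn_ge0//.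
by rewrite ler_norml; lra.
Qed.

(** A small piece near [x] has two distinct endpoints, one of which is not [x]. *)
Lemma cantor_limit_point : C `<=` limit_point C.
Proof.
move=> x Cx U /nbhs_ballP[e /= e0 eU].
have [s sx] := cantor_near_thirds Cx e0.
have s01 : thirds s 0 != thirds s 1.
  rewrite -subr_eq0 thirdsB mulf_neq0// ?invr_eq0 ?expf_neq0//; lra.
have [E|E] := eqVneq (thirds s 0) x; [exists (thirds s 1)|exists (thirds s 0)].
- rewrite -E eq_sym; split=> //; first exact/cantor_thirds/cantor1.
  by apply/eU/sx; rewrite ler01 lexx.
- split=> //; first exact/cantor_thirds/cantor0.
  by apply/eU/sx; rewrite ler01 lexx.
Qed.

(** If the image contained a ball of radius [e], it would contain [2^n + 1] points
with consecutive distances [e / 2 / 2^n]. Two of them would come from the same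
one of the [2^n] pieces of level [n], whence [e / 2 / 2^n <= L / 3^n], which
fails for large [n]. *)
Lemma interior_lipschitz_cantor (F : R -> R) (L : R) :
  (forall x y, 0 <= x <= 1 -> 0 <= y <= 1 -> `|F x - F y| <= L * `|x - y|) ->
  (F @` C)^° = set0.
Proof.
move=> FL; apply/seteqP; split=> // y /nbhs_ballP[e /= e0 eF].
have L0 : 0 <= L.
  have := FL 0 1; rewrite !lexx ler01 sub0r normrN normr1 mulr1 => /(_ isT isT).
  exact: le_trans.
have main n : e / 2 / 2 ^+ n <= L / 3 ^+ n.
  pose p (j : 'I_(2 ^ n).+1) : R := y + j%:R * (e / 2 / 2 ^+ n).
  have n2 : (0 : R) < 2 ^+ n by rewrite exprn_gt0.
  have /choice[f fP] j : exists t : n.-tuple bool,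
      exists2 z, C z & p j = F (thirds t z).
    have [|x Cx Fx] := eF (p j).
      rewrite /ball/= /p opprD addNKr normrN ger0_norm; last first.
        by rewrite mulr_ge0// divr_ge0 ?divr_ge0// ltW.
      rewrite mulrCA -[ltRHS]mulr1 (@le_lt_trans _ _ (e / 2 * 1))//.
        rewrite ler_wpM2l//; first lra.
        by rewrite ler_pdivrMr// mul1r -natrX ler_nat -ltnS.
      by rewrite ltr_pM2r//; lra.
    have [z Cz [t xt]] := cantor_thirds_inv n Cx.
    by exists t, z => //; rewrite -xt.
  have : ~~ injectiveb f.
    apply/injectiveP => /leq_card; rewrite card_ord card_tuple card_bool.
    by rewrite ltnn.
  case/injectivePn => i [j ij fij].
  have [z Cz zi] := fP i; have [w Cw wj] := fP j.
  have : `|p i - p j| <= L / 3 ^+ n.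
    rewrite zi wj fij.
    rewrite (le_trans (FL _ _ _ _))//; try exact/cantor_itv/cantor_thirds.
    rewrite ler_wpM2l// thirdsB size_tuple normrM.
    rewrite [X in _ * X]ger0_norm ?invr_ge0 ?exprn_ge0//.
    rewrite ler_piMl ?invr_ge0 ?exprn_ge0//.
    by have := cantor_itv Cz; have := cantor_itv Cw; rewrite ler_norml; lra.
  apply: le_trans; rewrite /p opprD addrACA subrr add0r -mulrBl normrM.
  rewrite [X in _ <= _ * X]ger0_norm; last by rewrite ltW// divr_gt0//; lra.
  rewrite ler_peMl//; first by rewrite ltW// divr_gt0//; lra.
  have ij' : (i < j)%N || (j < i)%N by rewrite -neq_ltn.
  by case/orP: ij'; rewrite -(ler_nat R) -natr1 => ij';
    rewrite ler_normr; apply/orP; [right|left]; lra.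
have [||n] := @geometric_small L (2 / 3) (e / 2); [lra|lra|].
rewrite expr_div_n mulrCA mulrC ltNge => /negP; apply.
by rewrite -ler_pdivrMr// exprn_gt0.
Qed.

End ternary.

(** * Exponential sums *)

Section exponential_sums.
Variable R : realType.

Definition exp_sum (I : Type) (s : seq I) (a g : I -> R) (x : R) : R :=
  \sum_(i <- s) a i * expR (g i * x).

Lemma is_derive_exp_sum (I : Type) (s : seq I) (a g : I -> R) (x : R) :
  is_derive x (1 : R) (exp_sum s a g) (exp_sum s (fun i => a i * g i) g x).
Proof.
elim: s => [|i s IH].
  rewrite /exp_sum big_nil (_ : (fun _ => _) = cst 0); last first.
    by apply/funext => y; rewrite big_nil.
  exact: is_derive_cst.
rewrite /exp_sum big_cons (_ : (fun _ => _) =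
    (fun y => a i * expR (g i * y)) + exp_sum s a g); last first.
  by apply/funext => y; rewrite big_cons.
apply: is_deriveD.
have dg : is_derive x (1 : R) ( *%R (g i)) (g i).
  rewrite -[X in is_derive _ _ _ X]mulr1.
  exact: (@is_deriveZ R R^o R^o id (g i) x 1 1 (is_derive_id _ _)).
rewrite -mulrA [g i * _]mulrC.
exact: (@is_deriveZ R R^o R^o (expR \o *%R (g i)) (a i) x 1 _ _).
Qed.

(** Accumulating zeros pass to the derivative, by Rolle's theorem between the
accumulation point, itself a zero, and the nearby zeros. *)
Lemma limit_point_zero_derive (f f' : R -> R) (p : R) :
  (forall x, is_derive x (1 : R) f (f' x)) ->
  limit_point [set x | f x = 0] p -> limit_point [set x | f' x = 0] p.
Proof.
move=> df lp.
have cf : continuous f.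
  move=> x; apply/differentiable_continuous/derivable1_diffP.
  by have [] := df x.
have fp : f p = 0.
  have : closed [set x | f x = 0].
    by apply: (@preimage_closed _ _ f [set 0]) => //; exact: closed_eq.
  by apply; exact: subset_limit_point.
have main x y : x < y -> f x = 0 -> f y = 0 -> exists2 z, x < z < y & f' z = 0.
  move=> xy fx fy; have [|||c cxy dc] := @Rolle R f x y xy.
  - by move=> z _; have [] := df z.
  - exact: continuous_subspaceT.
  - by rewrite fx fy.
  - exists c; first by move: cxy; rewrite in_itv.
    have := @derive_val _ _ _ _ _ _ _ (df c).
    by rewrite (@derive_val _ _ _ _ _ _ _ dc).
move=> U /nbhs_ballP[e /= e0 eU]; have [|z [zp fz]] := lp (ball p e).
  exact: nbhsx_ballx.
rewrite /ball/= => zpe.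
have [zltp|pltz|zp'] := ltgtP z p; last by rewrite zp' eqxx in zp.
- have [w /andP[zw wp] fw] := main _ _ zltp fz fp.
  exists w; split => //; first by rewrite lt_eqF.
  by apply: eU; rewrite /ball/=; move: zpe; rewrite !gtr0_norm ?subr_gt0//; lra.
- have [w /andP[pw wz] fw] := main _ _ pltz fp fz.
  exists w; split => //; first by rewrite gt_eqF.
  by apply: eU; rewrite /ball/=; move: zpe; rewrite !ltr0_norm ?subr_lt0//; lra.
Qed.

(** Induction on the number of terms: dividing the sum by one of its exponentials
turns the corresponding term into a constant, which differentiation removes,
while the other coefficients are multiplied by nonzero numbers. *)
Lemma exp_sum_limit_point_zero (I : eqType) (s : seq I) (a g : I -> R) (p : R) :
  uniq (map g s) -> limit_point [set x | exp_sum s a g x = 0] p ->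
  forall i, i \in s -> a i = 0.
Proof.
elim: s a g => // i0 s IH a g /= /andP[gi0 ug] lp.
pose h i := g i - g i0.
have EF x : exp_sum (i0 :: s) a h x =
    exp_sum (i0 :: s) a g x * expR (- (g i0 * x)).
  rewrite /exp_sum big_distrl; apply: eq_bigr => i _ /=.
  by rewrite -mulrA -expRD /h mulrBl.
have lp1 : limit_point [set x | exp_sum s (fun i => a i * h i) h x = 0] p.
  have -> : exp_sum s (fun i => a i * h i) h =
      exp_sum (i0 :: s) (fun i => a i * h i) h.
    by apply/funext => x; rewrite /exp_sum big_cons /h subrr mulr0 mul0r add0r.
  apply: limit_point_zero_derive => [x|].
    exact: (is_derive_exp_sum (i0 :: s) a h x).
  move=> U /lp[z [zp Fz Uz]]; exists z; split => //=.
  by rewrite EF Fz mul0r.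
have a0 i : i \in s -> a i = 0.
  move=> si; apply: (mulIf (x := h i)).
    rewrite subr_eq0; apply: contra gi0 => /eqP <-; exact: map_f.
  rewrite mul0r; apply: (IH _ _ _ lp1 i si).
  by rewrite (map_comp (fun x => x - g i0)) map_inj_uniq//; exact: addIr.
move=> i; rewrite inE => /orP[/eqP ->|]; last exact: a0.
have [|z [_ + _]] := lp setT; first exact: filterT.
rewrite /= /exp_sum big_cons big1_seq ?addr0; last first.
  by move=> j /andP[_ js]; rewrite a0// mul0r.
by move/eqP; rewrite mulf_eq0 (gt_eqF (expR_gt0 _)) orbF => /eqP.
Qed.

Lemma exp_sum_lipschitz (I : Type) (s : seq I) (a g : I -> R) :
  exists L, forall x y, 0 <= x <= 1 -> 0 <= y <= 1 ->
    `|exp_sum s a g x - exp_sum s a g y| <= L * `|x - y|.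
Proof.
exists (\sum_(i <- s) `|a i| * (expR `|g i| * `|g i|)) => x y x01 y01.
rewrite /exp_sum -sumrB mulr_suml; apply: (le_trans (ler_norm_sum _ _ _)).
apply: ler_sum => i _; rewrite -mulrBr normrM -!mulrA ler_wpM2l//.
have main u v : 0 <= u <= 1 -> 0 <= v <= 1 ->
   expR (g i * u) - expR (g i * v) <= expR `|g i| * (`|g i| * `|u - v|).
  move=> u01 v01.
  (* The exponential lies above its tangent line at [g i * u]. *)
  rewrite (@le_trans _ _ (expR (g i * u) * (g i * (u - v))))//.
    have := expR_ge1Dx (g i * (v - u)); rewrite -(ler_pM2l (expR_gt0 (g i * u))).
    by rewrite -expRD -mulrDr subrKC; lra.
  rewrite (@le_trans _ _ (expR (g i * u) * (`|g i| * `|u - v|)))//.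
    by rewrite ler_wpM2l ?expR_ge0// -normrM ler_norm.
  rewrite ler_wpM2r ?mulr_ge0// ler_expR (le_trans (ler_norm _))// normrM.
  by rewrite ler_piMr// ler_norml; lra.
rewrite ler_norml main// andbT lerNl opprB (le_trans (main _ _ _ _))//.
by rewrite distrC.
Qed.

Lemma continuous_exp_sum (I : Type) (s : seq I) (a g : I -> R) :
  continuous (exp_sum s a g).
Proof.
move=> x; apply/differentiable_continuous/derivable1_diffP.
by have [] := is_derive_exp_sum s a g x.
Qed.

End exponential_sums.

(** * Limit points along a dense sequence *)

Lemma injective_unbounded (f : nat -> nat) (N : nat) :
  injective f -> exists n, (N < f n)%N.
Proof.
move=> f_inj; apply: contrapT => H.
have fN n : (f n < N.+1)%N.
  by rewrite ltnNge; apply/negP => ?; apply: H; exists n.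
have : injective (fun i : 'I_N.+2 => Ordinal (fN i)).
  by move=> i j /(congr1 val)/f_inj; exact: val_inj.
by move=> /leq_card; rewrite !card_ord ltnn.
Qed.

Section lim.
Variable R : realType.
Local Notation C := (@ternary_cantor_set R).

Lemma frequently_LIM (x : nat -> R) (y : R) :
  (forall e N, 0 < e -> exists2 n, (N < n)%N & `|y - x n| < e) -> LIM x y.
Proof.
move=> xy.
have /choice[f fP] (kN : nat * nat) : exists n, (kN.2 < n)%N /\
    `|y - x n| < kN.1.+1%:R^-1.
  by have [|n] := xy kN.1.+1%:R^-1 kN.2; [rewrite invr_gt0|exists n].
pose fix u k := if k is j.+1 then f (k, u j) else f (0, 0)%N.
exists u; first by apply/increasing_seqP => k; exact: (fP (k.+1, u k)).1.
apply/cvgrPdist_lt => e e0.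
have := near_infty_natSinv_lt (PosNum e0); apply: filterS => k /=.
apply: le_lt_trans.
apply: ltW; case: k => [|k]; first exact: (fP (0, 0)%N).2.
exact: (fP (k.+1, u k)).2.
Qed.

(** The left endpoints of all pieces, each at infinitely many indices: one for
every second component of the coded pair. *)
Definition cantor_points (n : nat) : R :=
  if (unpickle n : option (seq bool * nat)) is Some (s, _) then thirds s 0 else 0.

Lemma cantor_points_mem n : C (cantor_points n).
Proof.
rewrite /cantor_points; case: unpickle => [[s _]|]; last exact: cantor0.
exact/cantor_thirds/cantor0.
Qed.

Lemma infinitely_often_thirds (s : seq bool) (N : nat) :
  exists2 n, (N < n)%N & cantor_points n = thirds s 0.
Proof.
have [|m Nm] := @injective_unbounded (fun m => pickle (s, m)) N.
  by move=> i j /(pcan_inj pickleK)[].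
by exists (pickle (s, m)); rewrite // /cantor_points pickleK.
Qed.

Lemma LIM_cantor_points (F : R -> R) : continuous F ->
  LIM (F \o cantor_points) = F @` C.
Proof.
move=> cF; apply/seteqP; split=> [y [u _ uy]|_ [x Cx <-]].
  have : closed (F @` C).
    apply: compact_closed; first exact: Rhausdorff.
    apply: continuous_compact; last exact: compact_cantor.
    exact: continuous_subspaceT.
  move=> clFC; apply: (closed_cvg _ clFC _ _ uy).
  by apply: nearW => n; exists (cantor_points (u n)) => //; exact: cantor_points_mem.
apply: frequently_LIM => e N e0.
have /cvgrPdist_lt/(_ _ e0)/nbhs_ballP[d /= d0 dF] := cF x.
have [s sx] := cantor_near_thirds Cx d0.
have [n Nn nE] := infinitely_often_thirds s N.
by exists n => //=; rewrite nE; apply/dF/sx; rewrite lexx ler01.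
Qed.

End lim.

(** * A rationally independent family of continuum many reals *)

(** The integer [J! * \sum_(j <= J | A j) 1/j!], by its recurrence in [J]. *)
Fixpoint fact_num (A : pred nat) (J : nat) : nat :=
  if J is j.+1 then (J * fact_num A j + A J)%N else A 0%N.

Section fact_expansion.
Variable R : realType.
Implicit Types A : pred nat.

Definition fact_partial A (J : nat) : R := (fact_num A J)%:R / J`!%:R.
(** The sum of the series of the [1/j!] with [j] in [A]. *)
Definition fact_real A : R := sup (range (fact_partial A)).

Lemma factr_gt0 n : (0 : R) < n`!%:R.
Proof. by rewrite ltr0n fact_gt0. Qed.

Lemma fact_partialS A J :
  fact_partial A J.+1 = fact_partial A J + (A J.+1)%:R / (J.+1)`!%:R.
Proof.
rewrite /fact_partial /= natrD mulrDl natrM factS natrM; congr (_ + _).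
by rewrite invfM mulrACA divff ?mul1r// pnatr_eq0.
Qed.

Lemma fact_partial_le A : {homo fact_partial A : m n / (m <= n)%N >-> m <= n}.
Proof.
apply: homo_leq => [//|x y z|J]; first exact: le_trans.
by rewrite fact_partialS lerDl divr_ge0.
Qed.

(** The partial sums increased by [2/(J+1)!], a bound for their tails, decrease;
they and the partial sums thus enclose the sum of the series. *)
Lemma fact_upper_ge A : {homo (fun J => fact_partial A J + 2 / (J.+1)`!%:R) :
  m n / (m <= n)%N >-> n <= m}.
Proof.
apply: homo_leq => [//|y x z xy yz|J]; first exact: le_trans yz xy.
rewrite fact_partialS -addrA lerD2l (factS J.+1) natrM invfM.
rewrite mulrA -mulrDl ler_pM2r ?invr_gt0 ?factr_gt0//.
have : (2 / J.+2%:R : R) <= 1 by rewrite ler_pdivrMr// mul1r ler_nat.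
by move: (2 / _) => t; case: (A _); rewrite ?mulr1n ?mulr0n; lra.
Qed.

Lemma fact_partial_upper A m n :
  fact_partial A n <= fact_partial A m + 2 / (m.+1)`!%:R.
Proof.
have [nm|mn] := leqP n m.
  by rewrite (le_trans (fact_partial_le A nm))// lerDl divr_ge0.
by rewrite (le_trans _ (fact_upper_ge A (ltnW mn)))// lerDl divr_ge0.
Qed.

Lemma fact_real_bounds A J :
  0 <= J`!%:R * fact_real A - (fact_num A J)%:R <= 2 / J.+1%:R.
Proof.
have ubA m : ubound (range (fact_partial A)) (fact_partial A m + 2 / (m.+1)`!%:R).
  by move=> _ [n _ <-]; exact: fact_partial_upper.
have lo : fact_partial A J <= fact_real A.
  apply: ub_le_sup; last by exists J.
  by exists (fact_partial A 0 + 2 / 1`!%:R); exact: (ubA 0%N).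
have hi : fact_real A <= fact_partial A J + 2 / (J.+1)`!%:R.
  by apply: ge_sup; [exists (fact_partial A 0), 0%N|exact: ubA].
have E : J`!%:R * fact_partial A J = (fact_num A J)%:R.
  by rewrite /fact_partial mulrC divfK// gt_eqF// factr_gt0.
have E2 : J`!%:R * (2 / (J.+1)`!%:R) = 2 / J.+1%:R :> R.
  by rewrite factS natrM invfM; field; rewrite !gt_eqF ?factr_gt0//.
move: lo hi; rewrite -(ler_pM2l (factr_gt0 J)) E => lo.
by rewrite -(ler_pM2l (factr_gt0 J)) mulrDr E E2 => hi; rewrite subr_ge0 lo lerBlDl.
Qed.

(** The sets [A i] need only have infinitely many private elements each. With [Z J]
the integer that approximates [J!] times the combination, [Z J = 0] for all
large [J], whereas [Z (J+1) = (J+1) * Z J + c i] when [J+1] is private to [A i]. *)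
Lemma fact_real_free (I : finType) (A : I -> pred nat) (c : I -> int) :
  (forall i N, exists2 j, (N < j)%N &
     A i j /\ forall i', i' != i -> ~~ A i' j) ->
  \sum_i (c i)%:~R * fact_real (A i) = 0 -> forall i, c i = 0.
Proof.
move=> priv c0 i.
pose Z J := \sum_i' c i' * (fact_num (A i') J)%:Z.
pose M := \sum_i' `|c i'|%N.
(* The remainder, at most [2 * M / (J + 1)], is then less than 1. *)
have Z0 J : (2 * M <= J)%N -> Z J = 0.
  move=> MJ; apply/eqP; rewrite -normr_le0 -ltzD1 add0r -(ltr_int R).
  have -> : (`|Z J|%:~R : R) = `|\sum_i' (c i')%:~R *
      (J`!%:R * fact_real (A i') - (fact_num (A i') J)%:R)|.
    under eq_bigr do rewrite mulrBr mulrCA.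
    rewrite sumrB -mulr_sumr c0 mulr0 sub0r normrN intr_norm; congr `|_|.
    by rewrite rmorph_sum; apply: eq_bigr => i' _; rewrite rmorphM.
  apply: (le_lt_trans (ler_norm_sum _ _ _)).
  apply: (@le_lt_trans _ _ (\sum_i' `|c i'|%N%:R * (2 / J.+1%:R))).
    apply: ler_sum => i' _; rewrite normrM natr_absz intr_norm ler_wpM2l//.
    by have /andP[? ?] := fact_real_bounds (A i') J; rewrite ger0_norm.
  rewrite -mulr_suml -natr_sum mulrA ltr_pdivrMr// mul1r -natrM ltr_nat.
  by rewrite ltnS mulnC.
have [[//|j] Mj [Aij Ai'j]] := priv i (2 * M)%N.
have : Z j.+1 = j.+1%:Z * Z j + c i.
  rewrite /Z mulr_sumr [X in _ = X + _](bigD1 i)//= (bigD1 i)//= Aij.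
  rewrite addrAC; congr (_ + _); first by rewrite PoszD PoszM mulrDr mulrCA mulr1.
  apply: eq_bigr => i' i'i; rewrite (negbTE (Ai'j _ i'i)) addn0 PoszM; ring.
by rewrite !Z0 ?mulr0 ?add0r// ltnW.
Qed.

(** The codes of the finite prefixes of [sigma]; two distinct sequences have only
finitely many prefixes in common. *)
Definition prefixes (sigma : nat -> bool) : pred nat := fun j =>
  if (unpickle j : option (seq bool)) is Some s
  then s == mkseq sigma (size s) else false.

Lemma prefixesE sigma tau n :
  prefixes sigma (pickle (mkseq tau n)) = (mkseq tau n == mkseq sigma n).
Proof. by rewrite /prefixes pickleK size_mkseq. Qed.

Lemma prefixes_private (I : finType) (sigma : I -> nat -> bool) :
  injective sigma -> forall i N, exists2 j, (N < j)%N &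
    prefixes (sigma i) j /\ forall i', i' != i -> ~~ prefixes (sigma i') j.
Proof.
move=> inj_sigma i N.
have /choice[d dP] i' : exists n, i' != i -> sigma i' n != sigma i n.
  have [->|i'i] := eqVneq i' i; first by exists 0%N; rewrite eqxx.
  apply: contrapT => H; move/eqP: i'i; apply; apply/inj_sigma/funext => n.
  by apply/eqP; apply: contrapT => /negP ?; apply: H; exists n.
pose D := \max_i' d i'.
have [|m Nm] := @injective_unbounded
    (fun m => pickle (mkseq (sigma i) (D.+1 + m))) N.
  move=> m n /(pcan_inj pickleK)/(congr1 size); rewrite !size_mkseq.
  exact: addnI.
exists (pickle (mkseq (sigma i) (D.+1 + m))) => //; rewrite prefixesE eqxx.
split=> // i' i'i; rewrite prefixesE; apply: contra (dP _ i'i) => /eqP E.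
have lt : (d i' < D.+1 + m)%N by rewrite ltn_addr// ltnS /D leq_bigmax.
by have := congr1 (fun s => nth true s (d i')) E; rewrite !nth_mkseq// => ->.
Qed.

Definition exponent (sigma : nat -> bool) : R := fact_real (prefixes sigma).

Lemma exponent_free (I : finType) (sigma : I -> nat -> bool) (c : I -> int) :
  injective sigma -> \sum_i (c i)%:~R * exponent (sigma i) = 0 ->
  forall i, c i = 0.
Proof. by move=> /prefixes_private/fact_real_free; exact. Qed.

Lemma exponent_inj : injective exponent.
Proof.
move=> s t st; apply: contrapT => /eqP sNt.
have := @exponent_free bool (fun b => if b then s else t)
  (fun b => if b then 1 else - 1) _ _ true; rewrite big_bool /= st mul1r mulN1r.
have i : injective (fun b : bool => if b then s else t).
  by case=> -[] //= E; rewrite E eqxx in sNt.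
by move=> /(_ i (subrr _)).
Qed.

End fact_expansion.

(** * The free algebra *)

Section generators.
Variable R : realType.
Local Notation C := (@ternary_cantor_set R).
Local Notation q := (@cantor_points R).

(** Both [F(C)] and the ternary Cantor set, its own image under the identity, are
homeomorphic to the Cantor space for the same reason. *)
Lemma lipschitz_image_cantor (F : R -> R) (L : R) :
  continuous F ->
  (forall x y, 0 <= x <= 1 -> 0 <= y <= 1 -> `|F x - F y| <= L * `|x - y|) ->
  (forall x, ~ limit_point [set y | F y = F x] x) ->
  is_cantor_set (F @` C).
Proof.
move=> cF FL nF.
have toK (G : R -> R) (M : R) : continuous G ->
    (forall x y, 0 <= x <= 1 -> 0 <= y <= 1 -> `|G x - G y| <= M * `|x - y|) ->
    (forall x, ~ limit_point [set y | G y = G x] x) ->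
    homeomorphic (G @` C) [set: cantor_space].
  move=> cG GM nG; apply: homeomorphic_cantor_space.
  - by exists (G 0); exists 0 => //; exact: cantor0.
  - apply: continuous_compact; last exact: compact_cantor.
    exact: continuous_subspaceT.
  - move=> _ [x Cx <-] U GxU.
    apply: contrapT => H; apply: (nG x) => V xV.
    have xU : nbhs x (G @^-1` U) := cG _ _ GxU.
    have [z [zx Cz [Uz Vz]]] := cantor_limit_point Cx (filterI xU xV).
    exists z; split=> //=; apply: contrapT => /eqP Gzx.
    by apply: H; exists (G z); split=> //; exists z.
  - exact: interior_lipschitz_cantor GM.
apply: homeomorphic_trans (toK F L cF FL nF) _; apply: homeomorphic_sym.
rewrite -(image_id C); apply: (toK id 1).
- by move=> x; exact: cvg_id.
- by move=> x y _ _; rewrite mul1r.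
- by move=> x /(_ setT filterT)[y [/eqP yx yx' _]].
Qed.

(** The exponent 0 is excluded so that a constant can be added to the sum as a
new term, indexed by [None]: minus the value at a point where the sum is supposed
to accumulate its value. *)
Lemma exp_sum_cantor (I : eqType) (s : seq I) (a g : I -> R) (i : I) :
  i \in s -> a i != 0 -> uniq (0 :: map g s) ->
  is_cantor_set (exp_sum s a g @` C).
Proof.
move=> si ai ug; have [L FL] := exp_sum_lipschitz s a g.
apply: lipschitz_image_cantor FL _; first exact: continuous_exp_sum.
move=> x lx.
pose a' o := if o is Some j then a j else - exp_sum s a g x.
pose g' o := if o is Some j then g j else 0.
have sE y : exp_sum (None :: map Some s) a' g' y =
    exp_sum s a g y - exp_sum s a g x.
  by rewrite /exp_sum big_cons big_map /= mul0r expR0 mulr1 addrC.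
suff: a' (Some i) = 0 by apply/eqP.
apply: (exp_sum_limit_point_zero (s := None :: map Some s) (g := g')
  (p := x)).
- by rewrite map_cons -map_comp.
- by move=> U /lx[y [yx /= Ey Uy]]; exists y; split=> //=; rewrite sE Ey subrr.
- by rewrite inE map_f.
Qed.

Lemma generator_bounded (b : R) : (fun n => expR (b * q n)) \in @bounded_seq R.
Proof.
apply/bounded_seqP; exists (expR `|b|) => n.
rewrite ger0_norm ?expR_ge0// ler_expR (le_trans (ler_norm _))//.
rewrite normrM ler_piMr//.
by have := cantor_itv (cantor_points_mem R n); rewrite ler_norml; lra.
Qed.

Definition generator (sigma : nat -> bool) : ellinfty R :=
  Ellinfty (generator_bounded (exponent R sigma)).

Lemma generator_inj : injective generator.
Proof.
move=> s t /(congr1 (@ellinfty_val R))/= st; apply: (@exponent_inj R).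
(* At this index the base sequence takes the nonzero value 2/3. *)
pose n := pickle ([:: true], 0%N).
have := congr1 (fun f : nat -> R => f n) st => /= /expR_inj; apply: mulIf.
by rewrite /cantor_points pickleK /= /third add0r mulf_neq0// ?invr_eq0; lra.
Qed.

Definition weight k (sigma : 'I_k -> nat -> bool) (m : multinom k) : R :=
  \sum_i (m i)%:R * exponent R (sigma i).

Lemma weight_inj k (sigma : 'I_k -> nat -> bool) :
  injective sigma -> injective (weight sigma).
Proof.
move=> inj_sigma m1 m2 /eqP; rewrite -subr_eq0 /weight -sumrB => /eqP E.
apply/mnmP => i.
have /(_ _ i) H := @exponent_free R _ sigma
  (fun i => (m1 i)%:Z - (m2 i)%:Z) inj_sigma.
apply/eqP; rewrite -eqz_nat -subr_eq0 H//.
by rewrite -[RHS]E; apply: eq_bigr => j _; rewrite rmorphB mulrBl.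
Qed.

Lemma poly_eval_generator k (P : mpoly k R) (sigma : 'I_k -> nat -> bool) n :
  poly_eval P (generator \o sigma) n =
  exp_sum (msupp P) (fun m => mcoeff m P) (weight sigma) (q n).
Proof.
rewrite /poly_eval /mmap /exp_sum.
rewrite (big_morph (fun x : ellinfty R => x n) (id1 := 0) (op1 := +%R))//.
apply: eq_bigr => m _; rewrite /mmap1.
rewrite -[LHS]/(mcoeff m P * 1 *
  (\prod_(i < k) (generator \o sigma) i ^+ m i : ellinfty R) n).
rewrite mulr1; congr (_ * _).
rewrite (big_morph (fun x : ellinfty R => x n) (id1 := 1) (op1 := *%R))//.
rewrite /weight mulr_suml expR_sum; apply: eq_bigr => i _.
rewrite (_ : ((generator \o sigma) i ^+ m i : ellinfty R) n =
    generator (sigma i) n ^+ m i).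
  by rewrite /= -expRM_natl mulrA.
by elim: (m i) => // d IH; rewrite !exprS -IH.
Qed.

(** The zero sequence has only one limit point, so that a value of a polynomial
is nonzero as soon as its limit points form a Cantor set. *)
Lemma not_cantor_LIM0 : ~ is_cantor_set (LIM (0 : ellinfty R)).
Proof.
move=> [f [g [_ _ _ gK]]].
have LIM0 y : LIM (0 : ellinfty R) y -> y = 0.
  move=> [u _ uy]; have {}uy : (fun _ : nat => 0 : R) @ \oo --> y := uy.
  by rewrite -(cvg_lim (@Rhausdorff R) uy) lim_cst.
have [/LIM0 g0 fg0] := gK _ (cantor0 R); have [/LIM0 g1 fg1] := gK _ (cantor1 R).
by have /eqP := oner_neq0 R; apply; rewrite -[LHS]fg1 g1 -[RHS]fg0 g0.
Qed.

End generators.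

Theorem theorem5p6 (R : realType) :
  strongly_algebrable [set: nat -> bool]
    [set x : ellinfty R | is_cantor_set (LIM x)].
Proof.
exists (range (@generator R)); split.
  by apply: inj_card_eq => s t _ _; exact: generator_inj.
move=> k P y k_gt0 P0 P00 inj_y Xy.
have /choice[sigma sigmaE] i : exists s, y i = generator R s.
  by have [s _ <-] := Xy i; exists s.
have {inj_y} inj_sigma : injective sigma.
  by move=> i j ij; apply: inj_y; rewrite !sigmaE ij.
have {sigmaE Xy} -> : y = @generator R \o sigma by exact/funext.
have S : is_cantor_set (LIM (poly_eval P (@generator R \o sigma))).
  have -> : ellinfty_val (poly_eval P (@generator R \o sigma)) =
      exp_sum (msupp P) (fun m => mcoeff m P) (weight R sigma)
        \o @cantor_points R.
    by apply/funext => n; exact: poly_eval_generator.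
  rewrite LIM_cantor_points; last exact: continuous_exp_sum.
  have [m Pm] : exists m, m \in msupp P.
    case E : (msupp P) => [|m s]; last by exists m; rewrite inE eqxx.
    by move: P0; rewrite -msupp_eq0 E.
  apply: (@exp_sum_cantor _ _ _ _ _ m) => //; first by rewrite -mcoeff_msupp.
  rewrite /= map_inj_uniq ?msupp_uniq ?andbT; last exact: weight_inj.
  apply/mapP => -[m' Pm' /esym].
  rewrite (_ : 0 = weight R sigma mnm0); last first.
    by rewrite /weight big1// => i _; rewrite mnm0E mul0r.
  move=> /(weight_inj inj_sigma) E.
  by move: Pm'; rewrite E mcoeff_msupp P00 eqxx.
split=> //; apply/eqP => P_0; move: S; rewrite P_0; exact: not_cantor_LIM0.
Qed.
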